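(* Let $n$ be a sufficiently large positive integer and $u$ an integer with $n^{6}\le u\le n^{C}$ for a fixed constant $C$. The expected maxload of $\mathbb{R}\mathsf{H}_u$ on the set $[n]=\{0,1,\dots,n-1\}$ is $\Theta(1)$.
   Context: $\mathfrak{m}_1(x)$ is the fractional part $x-\lfloor x\rfloor$ of a real $x$. Real hashing $\mathbb{R}\mathsf{H}_u$ into $n$ bins: choose a real $a$ uniformly from $(0,1)$ and place $x\in\{0,\dots,u-1\}$ in bin $\lfloor\mathfrak{m}_1(ax)/(1/n)\rfloor\in[n]$. The maxload on $X$ is the number of elements of $X$ in the fullest bin. *)

(* Defs.v *)
From HB Require Import structures.
From mathcomp Require Import all_boot all_order all_algebra.
From mathcomp Require Import all_classical all_reals all_analysis.

Set Implicit Arguments.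
Unset Strict Implicit.
Unset Printing Implicit Defensive.

Import Order.TTheory GRing.Theory Num.Theory.

Local Open Scope ring_scope.

Definition frac_part (R : realType) (x : R) : R := x - (Num.floor x)%:~R.

(* For 0 < n the value lies in {0, ..., n-1}. *)
Definition real_hash (R : realType) (u n : nat) (a : R) (x : 'I_u) : int :=
  Num.floor (frac_part (a * (x : nat)%:R) / (1 / n%:R)).

Definition maxload (n : nat) (T : finType) (h : T -> int) (X : {set T}) : nat :=
  \max_(b < n) #|[set x in X | h x == (b : nat)%:Z]|.

(* The key a is uniform on (0,1): uniform_prob ltr01 is defined with the density
   of the closed interval, which is the same Borel measure since the endpoints
   are null. *)
Definition expected_maxload (R : realType) (u n : nat) (X : {set 'I_u}) : \bar R :=
  expectation (uniform_prob (@ltr01 R))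
    (fun a : R => (maxload n (real_hash n a) X)%:R).

(* [n] = {0, ..., n-1} as a set of keys in the universe {0, ..., u-1} *)
Definition initial_keys (u n : nat) : {set 'I_u} := [set x : 'I_u | (x < n)%N].

(* Main.v *)
Require Import Defs.
From mathcomp Require Import all_boot all_order all_algebra.
From mathcomp Require Import all_classical all_reals all_analysis.
From mathcomp Require Import measurable_realfun ring lra zify.

(** Fix a in [0,1] and suppose that a bin receives more than k >= 1 keys of
    {0, ..., n-1}.  The points (x, floor (a x)), x ranging over these keys, are
    lattice points in a strip around the line of slope a; the determinant of two
    difference vectors x -> y -> z, x < y < z, is an integer of absolute value
    at most (z - x) / n < 1, hence 0.  So all these points lie on one line, of
    slope p/q in lowest terms, and consecutive ones are at distance at least q.
    With more than k points this gives k q <= n, and |a q - p| < 1 / (n k).  For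
    fixed k the set of such a has measure at most
    sum_(q <= n/k) (q+1) 2/(n k q) <= 4/k^2, which is summable in k, so that the
    expected maxload is at most 1 + 4 * 2.  It is at least 1, since key 0 always
    lands in bin 0. *)

Import Order.TTheory GRing.Theory Num.Theory.
Import numFieldNormedType.Exports.

Local Open Scope ring_scope.

(** * Expectations and the uniform measure *)

(* The integral of a nonnegative function being a supremum over simple functions
   below it, no measurability is needed, unlike in ge0_le_integral. *)
Lemma le_integralT_ge0 d (T : measurableType d) (R : realType)
    (mu : {measure set T -> \bar R}) (f g : T -> \bar R) :
  (forall t, 0 <= f t <= g t)%E -> (\int[mu]_t f t <= \int[mu]_t g t)%E.
Proof.
move=> fg; have f0 t : (0 <= f t)%E by case/andP: (fg t).
have f_le_g t : (f t <= g t)%E by case/andP: (fg t).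
rewrite ge0_integralTE // ge0_integralTE; last first.
  by move=> t; exact: le_trans (f_le_g t).
apply: ereal_sup_le => _ [h hf <-]; exists h => // t.
exact: le_trans (hf t) (f_le_g t).
Qed.

(** Layer-cake bound: [X t] counts the [k < n] with [k < X t], and each tail event is enlarged to
    the measurable set [E k] before integrating term by term. *)
Lemma expectation_nat_le_sum_tails d (T : measurableType d) (R : realType)
    (P : probability T R) (n : nat) (X : T -> nat) (E : nat -> set T) :
  (forall k, measurable (E k)) -> (forall t, (X t <= n)%N) ->
  (forall k t, (k < X t)%N -> E k t) ->
  ('E_P[fun t => (X t)%:R : R] <= \sum_(k < n) P (E k))%E.
Proof.
move=> mE Xn XE; rewrite unlock.
have X_le t : ((X t)%:R%:E <= \sum_(k < n) (\1_(E k) t)%:E :> \bar R)%E.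
  rewrite sumEFin lee_fin (le_trans (y := \sum_(k < n) (k < X t)%:R)) //.
    rewrite -natr_sum ler_nat -(big_mkord xpredT (fun k => (k < X t)%N : nat)).
    rewrite (big_cat_nat _ (Xn t)) //= (@leq_trans (\sum_(0 <= k < X t) 1)) //.
      by rewrite sum_nat_const_nat subn0 muln1.
    rewrite (leq_trans _ (leq_addr _ _)) // !big_nat.
    by apply: leq_sum => k /andP[_ ->].
  apply: ler_sum => k _; rewrite indicE.
  by case: (ltnP k (X t)) => [/XE kE|_]; [rewrite mem_set|rewrite ler0n].
apply: (@le_trans _ _ (\int[P]_t (\sum_(k < n) (\1_(E k) t)%:E))%E); last first.
  rewrite ge0_integral_sum //.
  - by apply: lee_sum => k _; rewrite integral_indic // setIT.
  - by move=> k; apply/measurable_EFinP; exact: measurable_indic.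
by apply: le_integralT_ge0 => t; rewrite lee_fin ler0n X_le.
Qed.

(** The density is at most 1 everywhere. *)
Lemma uniform_prob01_le (R : realType) (A : set R) : measurable A ->
  (uniform_prob (@ltr01 R) A <= lebesgue_measure A)%E.
Proof.
move=> mA; rewrite /uniform_prob.
apply: (@le_trans _ _ (\int[lebesgue_measure]_(x in A) cst 1%E x)%E);
  last by rewrite integral_cst // mul1e.
apply: ge0_le_integral => //.
- by move=> x _; rewrite lee_fin uniform_pdf_ge0.
- apply/measurable_EFinP; apply: measurable_funTS.
  exact: measurable_uniform_pdf.
- move=> x _ /=; rewrite lee_fin /uniform_pdf subr0 invr1.
  by case: ifP.
Qed.

Lemma uniform_prob_setC_itv (R : realType) (a b : R) (ab : a < b) :
  uniform_prob ab (~` `[a, b]) = 0%E.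
Proof.
rewrite /uniform_prob integral_uniform_pdf setICl.
exact: integral_set0.
Qed.

(** * Measure of the slopes close to a fraction of small denominator *)

(* The fraction p / (q + 1) stands for p / q in the argument above; p <= q + 1
   becomes p < q + 2. *)
Definition near_rational (R : realType) (n k : nat) : set R :=
  (\bigcup_(q < n %/ k) \bigcup_(p < q.+2)
    ball (p%:R / q.+1%:R : R) (n * k * q.+1)%:R^-1)%classic.

Lemma measurable_near_rational (R : realType) (n k : nat) :
  measurable (near_rational R n k).
Proof.
apply: fin_bigcup_measurable => // q _; apply: fin_bigcup_measurable => // p _.
exact: measurable_ball.
Qed.

(** Two union bounds. For denominator [q.+1] there are [q.+2 <= 2 * q.+1] balls of length
    [2 / (n * k * q.+1)], in total at most [4 / (n * k)] whatever [q] is; and there are at most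
    [n / k] denominators. *)
Lemma lebesgue_measure_near_rational_le (R : realType) (n k : nat) :
  (0 < n)%N -> (0 < k)%N ->
  (lebesgue_measure (near_rational R n k) <= (4 / k%:R ^+ 2)%:E)%E.
Proof.
move=> n0 k0; have n0R : 0 < n%:R :> R by rewrite ltr0n.
have k0R : 0 < k%:R :> R by rewrite ltr0n.
pose B q p : set R := ball (p%:R / q.+1%:R : R) (n * k * q.+1)%:R^-1.
pose A q : set R := (\bigcup_(p < q.+2) B q p)%classic.
have mB q p : measurable (B q p) by exact: measurable_ball.
have mA q : measurable (A q) by exact: fin_bigcup_measurable.
rewrite /near_rational bigcup_mkord.
apply: le_trans (@Boole_inequality _ _ _ lebesgue_measure A _ _) _.
  by move=> q _; exact: mA.
apply: (@le_trans _ _ (\sum_(q < n %/ k) (4 / (n * k)%:R)%:E)%E); last first.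
  rewrite sumEFin lee_fin sumr_const card_ord -[_ *+ _]mulr_natr.
  have : (n %/ k)%:R * k%:R <= n%:R :> R.
    by rewrite -natrM ler_nat leq_divM.
  rewrite natrM => nk.
  rewrite -ler_pdivlMl ?divr_gt0 ?mulr_gt0 //.
  rewrite [leRHS](_ : _ = n%:R / k%:R); last by field; lra.
  by rewrite ler_pdivlMr.
apply: lee_sum => q _; rewrite /A bigcup_mkord.
apply: le_trans (@Boole_inequality _ _ _ lebesgue_measure (B q) _ _) _.
  by move=> p _; exact: mB.
apply: (@le_trans _ _ (\sum_(p < q.+2) (2 / (n * k * q.+1)%:R)%:E)%E).
  apply: lee_sum => p _; rewrite mulr_natl.
  have r_ge0 : 0 <= (n * k * q.+1)%:R^-1 :> R by rewrite invr_ge0.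
  by rewrite -(lebesgue_measure_ball (p%:R / q.+1%:R) r_ge0).
rewrite sumEFin lee_fin sumr_const card_ord -[_ *+ _]mulr_natr !natrM.
have q0R : 0 < q.+1%:R :> R by rewrite ltr0n.
rewrite -ler_pdivlMl ?divr_gt0 ?mulr_gt0 //.
rewrite [leRHS](_ : _ = 2 * q.+1%:R); last by field; lra.
by rewrite -natrM ler_nat; lia.
Qed.

Lemma sum_inv_sqr_le (R : realFieldType) (n : nat) :
  \sum_(k < n) k.+1%:R^-2 <= 2 :> R.
Proof.
(* The sharper bound makes the induction work: with [x = n.+1], the slack gained is
   [2 / x - 2 / (x + 1) - 1 / x ^+ 2], which is nonnegative for [x >= 1]. *)
suff : \sum_(k < n) k.+1%:R^-2 <= 2 - 2 / n.+1%:R :> R.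
  by move=> /le_trans; apply; rewrite gerBl divr_ge0.
elim: n => [|n IH]; first by rewrite big_ord0 divr1 subrr.
rewrite big_ord_recr /=; apply: le_trans (lerD IH (lexx _)) _.
have n1 : (1 : R) <= n.+1%:R by rewrite ler1n.
rewrite -[n.+2%:R]natr1; set x := n.+1%:R in n1 *.
rewrite -subr_ge0 [leRHS](_ : _ = (x - 1) / (x ^+ 2 * (x + 1))).
  by rewrite divr_ge0 ?mulr_ge0 ?exprn_ge0 //; lra.
by field; apply/andP; split; lra.
Qed.

(** * Crowded bins and collinear lattice points *)

(** The divisibility hypothesis holds when the line from abscissa [lo] with direction [(D, M)] has a
    lattice point at [y]. Dividing [D] and [M] by their gcd [g] gives coprime [q] and [p], so [q]
    divides [y - lo]; the keys lie among the [g + 1] terms [lo, lo + q, ..., lo + g * q]. *)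
Lemma card_collinear_le (u : nat) (S : {set 'I_u}) (lo D M : nat) :
  (0 < D)%N ->
  (forall y : 'I_u, y \in S -> (lo <= y <= lo + D)%N) ->
  (forall y : 'I_u, y \in S -> (D %| (y - lo) * M)%N) ->
  (#|S| <= (gcdn D M).+1)%N.
Proof.
move=> D0 range_S col_S.
have g0 : (0 < gcdn D M)%N by rewrite gcdn_gt0 D0.
set g := gcdn D M in g0 *.
have DE : D = (D %/ g * g)%N by rewrite divnK ?dvdn_gcdl.
have ME : M = (M %/ g * g)%N by rewrite divnK ?dvdn_gcdr.
set q := (D %/ g)%N in DE; set p := (M %/ g)%N in ME.
have q0 : (0 < q)%N by rewrite divn_gt0 // dvdn_leq // dvdn_gcdl.
have coqp : coprime q p.
  by rewrite /coprime -(eqn_pmul2r g0) muln_gcdl -DE -ME mul1n.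
have q_dvd y : y \in S -> (q %| y - lo)%N.
  move=> /col_S; rewrite {1}DE {1}ME mulnA dvdn_pmul2r // Gauss_dvdl //.
pose f (y : 'I_u) : 'I_g.+1 := inord ((y - lo) %/ q).
have fE y : y \in S -> f y = ((y - lo) %/ q)%N :> nat.
  move=> yS; rewrite inordK // ltnS leq_divLR ?q_dvd // mulnC -DE.
  by move: (range_S _ yS); lia.
rewrite -(@card_in_imset _ _ f); first by rewrite -[leqRHS]card_ord max_card.
move=> x y xS yS /(congr1 (@nat_of_ord _)); rewrite !fE // => fxy.
apply: val_inj => /=; have /andP[lox _] := range_S _ xS.
have /andP[loy _] := range_S _ yS.
rewrite -(subnK lox) -(subnK loy).
by rewrite -(divnK (q_dvd _ xS)) -(divnK (q_dvd _ yS)) fxy.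
Qed.

(** The fractional parts multiplied by [n] have the same floor. *)
Lemma real_hash_eq_close (R : realType) (u n : nat) (a : R) (x y : 'I_u) :
  (0 < n)%N -> real_hash n a x = real_hash n a y ->
  n%:R * `|frac_part (a * (x : nat)%:R) - frac_part (a * (y : nat)%:R)| < 1.
Proof.
move=> n0; rewrite /real_hash; set s := frac_part _; set t := frac_part _ => st.
have n0' : (0 : R) < n%:R by rewrite ltr0n.
rewrite -{1}(gtr0_norm n0') -normrM ltr_norml.
have := floor_itv (s / (1 / n%:R)); have := floor_itv (t / (1 / n%:R)).
rewrite st intrD !div1r !invrK => /andP[? ?] /andP[? ?].
by apply/andP; split; lra.
Qed.

Lemma crowded_bin_rational_approx (R : realType) (u n k : nat) (a : R)
    (S : {set 'I_u}) (b : int) :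
  0 <= a <= 1 -> (0 < k < #|S|)%N ->
  (forall x : 'I_u, x \in S -> (x < n)%N) ->
  (forall x : 'I_u, x \in S -> real_hash n a x = b) ->
  exists q p : nat, [/\ (0 < q)%N, (k * q <= n)%N, (p <= q)%N &
    `|p%:R - a * q%:R| < (n * k)%:R^-1].
Proof.
move=> /andP[a0 a1] /andP[k0 kS] S_lt_n S_hash.
have /card_gt0P[x0 x0S] : (0 < #|S|)%N by lia.
have n0 : (0 < n)%N by have := S_lt_n _ x0S; lia.
(* Height of the lattice point above [x]; the absolute value changes nothing, as [a * x >= 0]. *)
pose m (x : nat) : nat := `|Num.floor (a * x%:R)|%N.
have mE x : (Num.floor (a * x%:R))%:~R = (m x)%:R :> R.
  by rewrite [RHS]pmulrn /m gez0_abs // floor_ge0 mulr_ge0.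
have close x y : x \in S -> y \in S ->
    n%:R * `|a * x%:R - (m x)%:R - (a * y%:R - (m y)%:R)| < 1.
  by move=> xS yS; rewrite -!mE; apply: real_hash_eq_close; rewrite ?S_hash.
have m_mono x y : (x <= y)%N -> (m x <= m y)%N.
  move=> xy; rewrite -lez_nat /m !gez0_abs ?floor_ge0 ?mulr_ge0 //.
  by apply: le_floor; rewrite ler_wpM2l ?ler_nat.
case: (@arg_minnP _ x0 (mem S) (fun x => x : nat) x0S) => lo loS lo_min.
case: (@arg_maxnP _ x0 (mem S) (fun x => x : nat) x0S) => hi hiS hi_max.
have lohi : (lo < hi)%N.
  rewrite ltnNge; apply/negP => hilo.
  suff : (#|S| <= 1)%N by lia.
  rewrite -(cards1 lo); apply/subset_leq_card/fintype.subsetP => y yS.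
  rewrite inE; apply/eqP/val_inj => /=.
  by have := lo_min _ yS; have := hi_max _ yS; move=> /=; lia.
(* The vector between the extreme lattice points; its reduction by the gcd gives the denominator and
   numerator sought. *)
pose D := (hi - lo)%N; pose M := (m hi - m lo)%N.
have D0 : (0 < D)%N by rewrite subn_gt0.
have Dn : (D < n)%N by have := S_lt_n _ hiS; rewrite /D; lia.
have DR : D%:R = hi%:R - lo%:R :> R by rewrite natrB // ltnW.
have MR : M%:R = (m hi)%:R - (m lo)%:R :> R by rewrite natrB // m_mono // ltnW.
have n0R : (0 : R) < n%:R by rewrite ltr0n.
have approxD : n%:R * `|M%:R - a * D%:R| < 1.
  rewrite distrC DR MR.
  have -> : a * (hi%:R - lo%:R) - ((m hi)%:R - (m lo)%:R) =
     a * hi%:R - (m hi)%:R - (a * lo%:R - (m lo)%:R) :> R by ring.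
  exact: close.
have n1R : (1 : R) <= n%:R by rewrite ler1n.
(* Since [a <= 1], [M < a * D + 1 <= D + 1], and both are integers. *)
have MD : (M <= D)%N.
  rewrite -ltnS -(ltr_nat R) -natr1.
  have aD : a * D%:R <= D%:R by rewrite ler_piMl.
  have := ler_norm (M%:R - a * D%:R).
  have : `|M%:R - a * D%:R| < 1.
    by apply: le_lt_trans approxD; rewrite ler_peMl.
  by lra.
have col_S (y : 'I_u) : y \in S -> (D %| (y - lo) * M)%N.
  move=> yS; have loy := lo_min _ yS; have yhi := hi_max _ yS.
  apply/dvdnP; exists (m y - m lo)%N.
  (* the determinant of lo -> y -> hi is an integer of absolute value < 1 *)
  have eps1 := close _ _ hiS yS; have eps2 := close _ _ yS loS.
  set e1 := _ - _ in eps1; set e2 := _ - _ in eps2.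
  have E : ((y - lo) * M)%:R - ((m y - m lo) * D)%:R =
      (hi%:R - y%:R) * e2 - (y%:R - lo%:R) * e1 :> R.
    by rewrite !natrM MR DR !natrB ?m_mono // /e1 /e2; ring.
  have hy : (0 : R) <= hi%:R - y%:R by rewrite subr_ge0 ler_nat.
  have yl : (0 : R) <= y%:R - lo%:R by rewrite subr_ge0 ler_nat.
  (* Both errors are below [1 / n] and their weights add up to [D], which is less than [n]. *)
  have : n%:R * `|(hi%:R - y%:R) * e2 - (y%:R - lo%:R) * e1| <= D%:R.
    apply: le_trans (ler_wpM2l (ltW n0R) (ler_normB _ _)) _.
    rewrite !normrM !(ger0_norm hy) !(ger0_norm yl) DR; nra.
  rewrite -E; set A := (_ * M)%N; set B := (_ * D)%N => AB.
  have {}AB : `|A%:R - B%:R| < 1 :> R.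
    rewrite -(ltr_pM2l n0R) mulr1; apply: le_lt_trans AB _.
    by rewrite ltr_nat.
  have := ler_norm (A%:R - B%:R : R).
  have := ler_norm (- (A%:R - B%:R : R)); rewrite normrN => ? ?.
  apply/eqP; rewrite eqn_leq -[(A <= B)%N]ltnS -[(B <= A)%N]ltnS.
  by rewrite -!(ltr_nat R) -!natr1; apply/andP; split; lra.
pose g := gcdn D M.
have kg : (k <= g)%N.
  rewrite -ltnS; apply: leq_trans kS (card_collinear_le _ _ _ _ _ D0 _ col_S).
  by move=> y yS; have := lo_min _ yS; have := hi_max _ yS; rewrite /D /=; lia.
have g0 : (0 < g)%N by lia.
have DE : (D %/ g * g)%N = D by rewrite divnK ?dvdn_gcdl.
have ME : (M %/ g * g)%N = M by rewrite divnK ?dvdn_gcdr.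
exists (D %/ g)%N, (M %/ g)%N; split.
- by rewrite divn_gt0 // dvdn_leq // dvdn_gcdl.
- apply: leq_trans (ltnW Dn); rewrite -[leqRHS]DE mulnC leq_mul2l.
  by rewrite kg orbT.
- by rewrite leq_div2r.
(* Dividing [approxD] by [g >= k] gains the factor [k] in the approximation. *)
have k0R : (0 : R) < k%:R by rewrite ltr0n.
rewrite natrM -[ltRHS]div1r ltr_pdivlMr ?mulr_gt0 // mulrC -mulrA.
apply: le_lt_trans approxD; rewrite ler_wpM2l // -{2}DE -{2}ME !natrM.
rewrite mulrA -mulrBl normrM [`|g%:R|]ger0_norm // [leRHS]mulrC.
by rewrite ler_wpM2r // ler_nat.
Qed.

(** * The maxload of the initial keys *)

Lemma maxload_gt (n : nat) (T : finType) (h : T -> int) (X : {set T})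
    (k : nat) :
  (k < maxload n h X)%N ->
  exists b : int, (k < #|[set x in X | h x == b]|)%N.
Proof.
move=> k_lt; have [/existsP[b kb]|/existsPn none] :=
  boolP [exists b : 'I_n, (k < #|[set x in X | h x == (b : nat)%:Z]|)%N].
  by exists (b : nat)%:Z.
suff : (maxload n h X <= k)%N by rewrite leqNgt k_lt.
by apply/bigmax_leqP => b _; rewrite leqNgt none.
Qed.

Lemma maxload_le_card (n : nat) (T : finType) (h : T -> int) (X : {set T}) :
  (maxload n h X <= #|X|)%N.
Proof.
apply/bigmax_leqP => b _; apply: subset_leq_card.
by apply/fintype.subsetP => x; rewrite inE => /andP[].
Qed.

Lemma card_initial_keys_le (u n : nat) : (#|initial_keys u n| <= n)%N.
Proof.
case: n => [|n].
  by rewrite leqn0 cards_eq0; apply/eqP/setP => x; rewrite !inE ltn0.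
rewrite -[leqRHS]card_ord.
rewrite -(@card_in_imset _ _ (fun x : 'I_u => inord x : 'I_n.+1)) ?max_card //.
move=> x y; rewrite !inE => xn yn /(congr1 (@nat_of_ord _)).
by rewrite !inordK // => /val_inj.
Qed.

Lemma maxload_initial_keys_gt0 (R : realType) (u n : nat) (a : R) :
  (0 < n)%N -> (0 < u)%N ->
  (0 < maxload n (real_hash n a) (initial_keys u n))%N.
Proof.
move=> n0 u0; apply: (leq_trans _ (leq_bigmax (Ordinal n0))).
apply/card_gt0P; exists (Ordinal u0); rewrite !inE n0 /=.
by rewrite /real_hash /frac_part mulr0 floor0 subrr mul0r floor0.
Qed.

Lemma maxload_gt_near_rational (R : realType) (u n k : nat) (a : R) :
  0 <= a <= 1 -> (0 < k)%N ->
  (k < maxload n (real_hash n a) (initial_keys u n))%N ->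
  near_rational R n k a.
Proof.
move=> a01 k0 /maxload_gt[b kb].
set S := [set x in _ | _] in kb.
have [|x|x|] := @crowded_bin_rational_approx R u n k a S b a01.
- by rewrite k0.
- by rewrite !inE => /andP[].
- by rewrite !inE => /andP[_ /eqP].
move=> [|q] [p [// _ kq pq approx]].
exists q => /=; first by rewrite leq_divRL // mulnC.
exists p => //=; rewrite -ball_normE /ball_ /=.
have q0R : 0 < q.+1%:R :> R by rewrite ltr0n.
rewrite natrM invfM ltr_pdivlMr // -[X in _ * X < _](gtr0_norm q0R).
rewrite -normrM mulrBl.
by rewrite divfK ?gt_eqF.
Qed.

Theorem mainTheorem11 (R : realType) (C : R) :
  exists (c1 c2 : R) (n0 : nat),
    0 < c1 /\ 0 < c2 /\
    forall n u : nat,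
      (0 < n)%N -> (n0 <= n)%N ->
      (n ^ 6 <= u)%N -> u%:R <= n%:R `^ C ->
      (c1%:E <= expected_maxload R n (initial_keys u n) <= c2%:E)%E.
Proof.
exists 1, 9, 0%N; split=> //; split=> // -[//|n] u _ _ nu _.
have u0 : (0 < u)%N by apply: leq_trans nu; rewrite expn_gt0.
apply/andP; split.
  rewrite -(expectation_cst (uniform_prob (@ltr01 R)) 1).
  rewrite /expected_maxload unlock.
  apply: le_integralT_ge0 => t; rewrite !lee_fin ler01 ler1n.
  exact: maxload_initial_keys_gt0.
(* Supersets of the tail events. Tail 0 is bounded trivially by probability 1; for [k > 0] the null
   set outside [[0, 1]] is added because the expectation ranges over all real keys, while the
   approximation argument requires [0 <= a <= 1]. *)
pose E k : set R :=
  if k is 0%N then setT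
  else (~` `[0%R, 1%R] `|` near_rational R n.+1 k)%classic.
have mE k : measurable (E k).
  case: k => [|k] /=; first exact: measurableT.
  apply: measurableU; last exact: measurable_near_rational.
  by apply: measurableC; exact: measurable_itv.
have load_n (a : R) :
    (maxload n.+1 (real_hash n.+1 a) (initial_keys u n.+1) <= n.+1)%N.
  exact: leq_trans (maxload_le_card _ _ _ _) (card_initial_keys_le _ _).
have load_E k (a : R) :
    (k < maxload n.+1 (real_hash n.+1 a) (initial_keys u n.+1))%N -> E k a.
  case: k => [|k] //= ka.
  have [a01|/negP a01] := boolP (0 <= a <= 1).
    by right; exact: maxload_gt_near_rational ka.
  by left; rewrite /= in_itv.
rewrite /expected_maxload.
apply: le_trans (expectation_nat_le_sum_tails _ _ _ (uniform_prob (@ltr01 R))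
  _ _ _ mE load_n load_E) _.
rewrite big_ord_recl /= probability_setT.
apply: (@le_trans _ _ (1 + \sum_(k < n) (4 / k.+1%:R ^+ 2)%:E)%E).
  rewrite leeD2l // lee_sum // => k _; rewrite /bump /=.
  apply: (le_trans (measureU2 _ _ _)).
  - by apply: measurableC; exact: measurable_itv.
  - exact: measurable_near_rational.
  rewrite -[leRHS]add0e; apply: leeD.
    by rewrite le_eqVlt; apply/predU1P; left; exact: uniform_prob_setC_itv.
  apply: (@le_trans _ _ (lebesgue_measure (near_rational R n.+1 k.+1))).
    by apply: uniform_prob01_le; exact: measurable_near_rational.
  exact: lebesgue_measure_near_rational_le.
rewrite sumEFin -EFinD lee_fin -mulr_sumr.
by have := sum_inv_sqr_le R n; lra.
Qed.
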